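(* Let $U,V\in\mathcal{U}(n)$. There exists a unique minimal curve between $U$ and $V$ if and only if $\sigma(U^*V)\subseteq\{e^{i\theta},e^{-i\theta}\}$ for some real $\theta$ with $|\theta|<\pi$.
   Context: $\mathcal{U}(n)$ is the group of $n\times n$ complex unitary matrices, $\sigma(\cdot)$ is the set of eigenvalues and $\|\cdot\|_\infty$ is the spectral (operator) norm. The length of a (piecewise smooth) curve $\alpha:[0,1]\to\mathcal{U}(n)$ is $L(\alpha)=\int_0^1\|\dot\alpha(t)\|_\infty\,dt$, and $d_\infty(U,V)$ is the infimum of the lengths of piecewise smooth curves in $\mathcal{U}(n)$ joining $U$ with $V$. A curve joining $U$ with $V$ is minimal if its length equals $d_\infty(U,V)$. Convention: minimal curves are parametrized by $[0,1]$ so that $t\mapsto\|\dot\alpha(t)\|_\infty$ is constant (uniqueness is understood with this normalization). *)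

(* Defs.v *)
From HB Require Import structures.
From mathcomp Require Import all_boot all_order all_algebra.
From mathcomp Require Import complex.
From mathcomp Require Import all_classical all_reals all_analysis.

Set Implicit Arguments.
Unset Strict Implicit.
Unset Printing Implicit Defensive.

Import Order.TTheory GRing.Theory Num.Theory.
Import numFieldNormedType.Exports.

Local Open Scope classical_set_scope.
Local Open Scope ring_scope.
Local Open Scope sesquilinear_scope.
Local Open Scope complex_scope.

Section UnitaryCurves.
Context {R : realType}.

Definition cexpi (theta : R) : R[i] := cos theta +i* sin theta.

Definition spectrum n (A : 'M[R[i]]_n) : set R[i] := [set l | eigenvalue A l].

Definition l2norm n (x : 'cV[R[i]]_n) : R :=
  Num.sqrt (\sum_i ComplexField.Normc.normc (x i 0) ^+ 2).

Definition spectral_norm n (A : 'M[R[i]]_n) : R :=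
  sup [set l2norm (A *m x) | x in [set x : 'cV[R[i]]_n | l2norm x <= 1]].

(* R[i] carries no real normed-module structure in the library, so
   differentiation of t |-> a t is done on the real and imaginary parts of the
   entries. *)
Definition entry_re n (a : R -> 'M[R[i]]_n) i j : R -> R :=
  fun t => complex.Re (a t i j).

Definition entry_im n (a : R -> 'M[R[i]]_n) i j : R -> R :=
  fun t => complex.Im (a t i j).

Definition mx_derivable n (a : R -> 'M[R[i]]_n) (t : R) : Prop :=
  forall i j, derivable (entry_re a i j) t 1 /\ derivable (entry_im a i j) t 1.

Definition velocity n (a : R -> 'M[R[i]]_n) (t : R) : 'M[R[i]]_n :=
  \matrix_(i, j) (derive1 (entry_re a i j) t +i* derive1 (entry_im a i j) t : R[i]).

Definition smooth (f : R -> R) : Prop :=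
  forall (k : nat) (t : R), derivable (derive1n k f) t 1.

Definition mx_smooth n (a : R -> 'M[R[i]]_n) : Prop :=
  forall i j, smooth (entry_re a i j) /\ smooth (entry_im a i j).

(* A curve on [0, 1] is a total function R -> 'M_n of which only the values on
   [0, 1] matter. On each closed piece of the partition 0 :: s it is smooth in
   the sense that it has a smooth (C^oo) extension to R, hence one-sided
   derivatives of all orders at the breakpoints; consecutive pieces share a
   breakpoint, so the curve is continuous on [0, 1]. *)
Definition piecewise_smooth n (a : R -> 'M[R[i]]_n) : Prop :=
  exists s : seq R, itv_partition 0 1 s /\
    forall k, (k < size s)%N ->
      exists g : R -> 'M[R[i]]_n, mx_smooth g /\
        {in `[nth 0 (0 :: s) k, nth 0 (0 :: s) k.+1], a =1 g}.

Definition joins n (U V : 'M[R[i]]_n) (a : R -> 'M[R[i]]_n) : Prop :=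
  [/\ piecewise_smooth a,
      {in `[0, 1], forall t, a t \is unitarymx},
      a 0 = U & a 1 = V].

(* The velocity takes arbitrary values at the (finitely many) points of [0, 1]
   where the curve is not differentiable, which does not affect the integral. *)
Definition curve_length n (a : R -> 'M[R[i]]_n) : \bar R :=
  (\int[lebesgue_measure]_(t in `[0%R, 1%R]) (spectral_norm (velocity a t))%:E)%E.

Definition dist_spectral n (U V : 'M[R[i]]_n) : \bar R :=
  ereal_inf [set curve_length a | a in [set a | joins U V a]].

Definition constant_speed n (a : R -> 'M[R[i]]_n) : Prop :=
  exists c : R, forall t, t \in `]0, 1[ -> mx_derivable a t ->
    spectral_norm (velocity a t) = c.

Definition minimal_curve n (U V : 'M[R[i]]_n) (a : R -> 'M[R[i]]_n) : Prop :=
  [/\ joins U V a, curve_length a = dist_spectral U V & constant_speed a].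

Definition unique_minimal_curve n (U V : 'M[R[i]]_n) : Prop :=
  exists a, minimal_curve U V a /\
    forall b, minimal_curve U V b -> {in `[0, 1], b =1 a}.

End UnitaryCurves.

(* Main.v *)
(* Write U^* V = P^* diag(e^{i th_j}) P with th_j in ]-pi, pi], let T be the
   largest |th_j|, and let x_j be the j-th eigenvector.

   The orbit t |-> a t x of a unit vector under a curve of unitaries stays on
   the unit sphere and moves no faster than a, so the spherical distance of its
   endpoints bounds the length of a from below. For x = x_j this distance is
   |th_j|; since U P^* diag(e^{i t th_j}) P has constant speed T, the distance
   from U to V is T.

   If T < pi and every |th_j| equals T, a constant-speed minimal curve moves each
   x_j along the unique great circle arc between its endpoints, which determines
   the curve. Otherwise minimality leaves some phase free: if th_k = pi, the
   phase t th_k can be replaced by - t pi, and if |th_j| < T, by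
   t th_j + (T - |th_j|) t (1 - t). *)
Require Import Defs.
From mathcomp Require Import all_boot all_order all_algebra.
From mathcomp Require Import complex.
From mathcomp Require Import all_classical all_reals all_analysis.
From mathcomp Require Import measurable_realfun ring lra.
Import Order.TTheory GRing.Theory Num.Theory.
Import numFieldNormedType.Exports.
Local Open Scope classical_set_scope.
Local Open Scope ring_scope.
Local Open Scope sesquilinear_scope.
Local Open Scope complex_scope.

Set Implicit Arguments.
Unset Strict Implicit.
Unset Printing Implicit Defensive.

(** * Real inner product and spectral norm *)

Section RealInnerProduct.
Context {R : realType}.
Implicit Types n : nat.

(* The real inner product underlying the Hermitian one, so that [rdot x y] is the
   cosine of the spherical distance of two unit vectors. *)
Definition rdot n (x y : 'cV[R[i]]_n) : R := complex.Re ((x^t* *m y) 0 0).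

Lemma ReD (a b : R[i]) : complex.Re (a + b) = complex.Re a + complex.Re b.
Proof. by case: a b => [? ?] [? ?]. Qed.

Lemma ImD (a b : R[i]) : complex.Im (a + b) = complex.Im a + complex.Im b.
Proof. by case: a b => [? ?] [? ?]. Qed.

Lemma Re_scale (r : R) (a : R[i]) : complex.Re (r%:C * a) = r * complex.Re a.
Proof. by case: a => a b /=; rewrite mul0r subr0. Qed.

Lemma Im_scale (r : R) (a : R[i]) : complex.Im (r%:C * a) = r * complex.Im a.
Proof. by case: a => a b /=; rewrite mul0r addr0. Qed.

Lemma Re_conj_mul (a b : R[i]) : complex.Re (a^* * b)%R =
  complex.Re a * complex.Re b + complex.Im a * complex.Im b.
Proof. by case: a b => [a b] [c d] /=; rewrite mulNr opprK. Qed.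

Lemma Re_sum (I : Type) (r : seq I) (P : pred I) (F : I -> R[i]) :
  complex.Re (\sum_(i <- r | P i) F i) = \sum_(i <- r | P i) complex.Re (F i).
Proof. by elim/big_rec2: _ => // i x y _ <-; rewrite ReD. Qed.

Lemma rdotE n (x y : 'cV[R[i]]_n) : rdot x y =
  \sum_i (complex.Re (x i 0) * complex.Re (y i 0) +
          complex.Im (x i 0) * complex.Im (y i 0)).
Proof.
rewrite /rdot mxE Re_sum; apply: eq_bigr => i _.
by rewrite !mxE Re_conj_mul.
Qed.

Lemma rdotC n (x y : 'cV[R[i]]_n) : rdot x y = rdot y x.
Proof. by rewrite !rdotE; apply: eq_bigr => i _; congr (_ + _); rewrite mulrC. Qed.

Lemma rdotDr n (x y z : 'cV[R[i]]_n) : rdot x (y + z) = rdot x y + rdot x z.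
Proof. by rewrite /rdot mulmxDr mxE ReD. Qed.

Lemma rdotZr n (r : R) (x y : 'cV[R[i]]_n) : rdot x (r%:C *: y) = r * rdot x y.
Proof. by rewrite /rdot -scalemxAr mxE Re_scale. Qed.

Lemma rdotNr n (x y : 'cV[R[i]]_n) : rdot x (- y) = - rdot x y.
Proof. by rewrite -mulN1r -rdotZr rmorphN rmorph1 scaleN1r. Qed.

Lemma rdotDl n (x y z : 'cV[R[i]]_n) : rdot (x + y) z = rdot x z + rdot y z.
Proof. by rewrite ![rdot _ z]rdotC rdotDr. Qed.

Lemma rdotZl n (r : R) (x y : 'cV[R[i]]_n) : rdot (r%:C *: x) y = r * rdot x y.
Proof. by rewrite ![rdot _ y]rdotC rdotZr. Qed.

Lemma rdotNl n (x y : 'cV[R[i]]_n) : rdot (- x) y = - rdot x y.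
Proof. by rewrite ![rdot _ y]rdotC rdotNr. Qed.

Lemma trmxC_mul m n p (A : 'M[R[i]]_(m, n)) (B : 'M[R[i]]_(n, p)) :
  (A *m B)^t* = B^t* *m A^t*.
Proof. by rewrite trmx_mul map_mxM. Qed.

Lemma rdot_mulmxl m n (A : 'M[R[i]]_(m, n)) (x : 'cV[R[i]]_n) (y : 'cV[R[i]]_m) :
  rdot (A *m x) y = rdot x (A^t* *m y).
Proof. by rewrite /rdot trmxC_mul mulmxA. Qed.

Lemma rdotxx_ge0 n (x : 'cV[R[i]]_n) : 0 <= rdot x x.
Proof. by rewrite rdotE sumr_ge0// => i _; rewrite addr_ge0// -expr2 sqr_ge0. Qed.

Lemma l2normE n (x : 'cV[R[i]]_n) : l2norm x = Num.sqrt (rdot x x).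
Proof.
rewrite /l2norm rdotE; congr Num.sqrt; apply: eq_bigr => i _.
case: (x i 0) => a b /=; rewrite sqr_sqrtr ?expr2//.
by rewrite addr_ge0// -expr2 sqr_ge0.
Qed.

Lemma l2norm_sqr n (x : 'cV[R[i]]_n) : l2norm x ^+ 2 = rdot x x.
Proof. by rewrite l2normE sqr_sqrtr// rdotxx_ge0. Qed.

Lemma l2norm_ge0 n (x : 'cV[R[i]]_n) : 0 <= l2norm x.
Proof. by rewrite sqrtr_ge0. Qed.

Lemma rdotxx_eq0 n (x : 'cV[R[i]]_n) : rdot x x = 0 -> x = 0.
Proof.
rewrite rdotE => /eqP; rewrite psumr_eq0; last first.
  by move=> i _; rewrite addr_ge0// -expr2 sqr_ge0.
move=> /allP x0; apply/matrixP => i j; rewrite ord1 mxE.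
have := x0 i; rewrite mem_index_enum => /(_ isT).
rewrite paddr_eq0 -?expr2 ?sqr_ge0// !sqrf_eq0 => /andP[].
by case: (x i 0) => a b /= /eqP -> /eqP ->.
Qed.

Lemma cauchy_schwarz n (x y : 'cV[R[i]]_n) : `|rdot x y| <= l2norm x * l2norm y.
Proof.
have H (a b : R) : 0 <= a ^+ 2 * rdot x x + 2 * a * b * rdot x y + b ^+ 2 * rdot y y.
  have := rdotxx_ge0 (a%:C *: x + b%:C *: y).
  rewrite rdotDl !rdotDr !rdotZl !rdotZr (rdotC y x).
  by congr (_ <= _); ring.
rewrite -(ler_pXn2r (n := 2)) ?nnegrE ?mulr_ge0 ?l2norm_ge0//.
rewrite real_normK ?num_real// exprMn !l2norm_sqr.
have [y0|y0] := eqVneq (rdot y y) 0.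
  have -> : y = 0 by exact: rdotxx_eq0.
  by rewrite /rdot !mulmx0 mxE /= expr0n mulr0.
have ypos : 0 < rdot y y by rewrite lt_neqAle eq_sym y0 rdotxx_ge0.
(* This choice of coefficients turns the nonnegative quadratic form into [rdot y y] times the Gram
   determinant of [x] and [y]. *)
have := H (rdot y y) (- rdot x y).
have -> : rdot y y ^+ 2 * rdot x x + 2 * rdot y y * - rdot x y * rdot x y +
          (- rdot x y) ^+ 2 * rdot y y =
          rdot y y * (rdot x x * rdot y y - rdot x y ^+ 2) by ring.
by rewrite pmulr_rge0// subr_ge0.
Qed.

Lemma l2norm0 n : l2norm (0 : 'cV[R[i]]_n) = 0.
Proof. by rewrite l2normE /rdot mulmx0 mxE sqrtr0. Qed.

Lemma l2normD n (x y : 'cV[R[i]]_n) : l2norm (x + y) <= l2norm x + l2norm y.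
Proof.
rewrite -(ler_pXn2r (n := 2)) ?nnegrE ?addr_ge0 ?l2norm_ge0//.
rewrite l2norm_sqr rdotDl !rdotDr sqrrD !l2norm_sqr (rdotC y x).
have := ler_norm (rdot x y); have := cauchy_schwarz x y; nra.
Qed.

Lemma l2normZ n (c : R[i]) (x : 'cV[R[i]]_n) :
  l2norm (c *: x) = ComplexField.Normc.normc c * l2norm x.
Proof.
rewrite /l2norm -[X in _ = X * _]ger0_norm; last by case: c => a b; rewrite sqrtr_ge0.
rewrite -sqrtr_sqr -sqrtrM ?sqr_ge0//; congr Num.sqrt.
rewrite mulr_sumr; apply: eq_bigr => i _.
by rewrite mxE ComplexField.Normc.normcM exprMn.
Qed.

Lemma l2norm_sum n (I : Type) (r : seq I) (F : I -> 'cV[R[i]]_n) :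
  l2norm (\sum_(i <- r) F i) <= \sum_(i <- r) l2norm (F i).
Proof.
elim/big_rec2: _ => [|i y x _ h]; first by rewrite l2norm0.
by rewrite (le_trans (l2normD _ _))// lerD2l.
Qed.

Lemma unitarymx_mulVmx n (A : 'M[R[i]]_n) : A \is unitarymx -> A^t* *m A = 1%:M.
Proof.
by move=> uA; rewrite -(invmx_unitary uA) mulVmx// unitarymx_unit.
Qed.

Lemma rdot_unitary n (A : 'M[R[i]]_n) (x y : 'cV[R[i]]_n) : A \is unitarymx ->
  rdot (A *m x) (A *m y) = rdot x y.
Proof. by move=> uA; rewrite rdot_mulmxl mulmxA unitarymx_mulVmx// mul1mx. Qed.

Lemma l2norm_unitary n (A : 'M[R[i]]_n) (x : 'cV[R[i]]_n) : A \is unitarymx ->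
  l2norm (A *m x) = l2norm x.
Proof. by move=> uA; rewrite !l2normE rdot_unitary. Qed.

Lemma l2norm_unitaryC n (A : 'M[R[i]]_n) (x : 'cV[R[i]]_n) : A \is unitarymx ->
  l2norm (A^t* *m x) = l2norm x.
Proof. by move=> uA; rewrite l2norm_unitary// trmxC_unitary. Qed.

Lemma l2norm1P n (x : 'cV[R[i]]_n) : l2norm x = 1 <-> rdot x x = 1.
Proof.
rewrite -l2norm_sqr; split=> [->|/eqP]; rewrite ?expr1n//.
by rewrite sqrp_eq1 ?l2norm_ge0// => /eqP.
Qed.

Lemma rdot_le1 n (x y : 'cV[R[i]]_n) : l2norm x = 1 -> l2norm y = 1 ->
  `|rdot x y| <= 1.
Proof. by move=> x1 y1; have := cauchy_schwarz x y; rewrite x1 y1 mulr1. Qed.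

(** The squared norm of [x - y] is [2 - 2 * rdot x y], which cannot be positive here. *)
Lemma rdot_ge1_eq n (x y : 'cV[R[i]]_n) : l2norm x = 1 -> l2norm y = 1 ->
  1 <= rdot x y -> x = y.
Proof.
move=> /l2norm1P x1 /l2norm1P y1 xy; apply/eqP; rewrite -subr_eq0; apply/eqP.
apply: rdotxx_eq0; apply/eqP; rewrite eq_le rdotxx_ge0 andbT.
rewrite rdotDl !rdotDr !rdotNl !rdotNr (rdotC y x) x1 y1; lra.
Qed.

End RealInnerProduct.

(** * The spectral norm: attained bounds and continuity in the entries *)

Section SpectralNorm.
Context {R : realType}.
Implicit Types n : nat.

Lemma normc_ge0 (c : R[i]) : 0 <= ComplexField.Normc.normc c.
Proof. by case: c => a b; rewrite sqrtr_ge0. Qed.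

Lemma normc_le_ReIm (c : R[i]) :
  ComplexField.Normc.normc c <= `|complex.Re c| + `|complex.Im c|.
Proof.
case: c => a b /=; rewrite -[leRHS]ger0_norm ?addr_ge0// -sqrtr_sqr ler_wsqrtr//.
rewrite sqrrD !real_normK ?num_real// addrAC lerDl mulrn_wge0// mulr_ge0//.
Qed.

Lemma normc_coord_le n (x : 'cV[R[i]]_n) i :
  ComplexField.Normc.normc (x i 0) <= l2norm x.
Proof.
rewrite /l2norm -[leLHS]ger0_norm ?normc_ge0// -sqrtr_sqr ler_wsqrtr//.
by rewrite (bigD1 i)//= lerDl sumr_ge0// => j _; rewrite sqr_ge0.
Qed.

Lemma l2norm_delta n (i : 'I_n) : l2norm (delta_mx i 0 : 'cV[R[i]]_n) = 1.
Proof.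
rewrite /l2norm (bigD1 i)//= mxE !eqxx big1 => [|j /negPf ji].
  by rewrite addr0 ComplexField.Normc.normc1 expr1n sqrtr1.
by rewrite mxE ji ComplexField.Normc.normc0 expr0n.
Qed.

(** A crude entrywise bound, enough to make the supremum in [spectral_norm] finite and to control
    how it varies with the entries. *)
Lemma l2norm_mulmx_le_sum n (A : 'M[R[i]]_n) (x : 'cV[R[i]]_n) : l2norm x <= 1 ->
  l2norm (A *m x) <= \sum_i \sum_j ComplexField.Normc.normc (A i j).
Proof.
move=> x1.
have -> : A *m x = \sum_i \sum_j (A i j * x j 0) *: delta_mx i 0.
  apply/colP => i; rewrite mxE summxE [RHS](bigD1 i)//= [X in _ + X]big1 ?addr0.
    by rewrite summxE; apply: eq_bigr => j _; rewrite !mxE !eqxx mulr1.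
  move=> k ki; rewrite summxE big1// => j _.
  by rewrite !mxE [i == k]eq_sym (negPf ki) mulr0.
rewrite (le_trans (l2norm_sum _ _))// ler_sum// => i _.
rewrite (le_trans (l2norm_sum _ _))// ler_sum// => j _.
rewrite l2normZ l2norm_delta mulr1 ComplexField.Normc.normcM.
by rewrite ler_piMr ?normc_ge0// (le_trans (normc_coord_le _ _)).
Qed.

Let unit_image n (A : 'M[R[i]]_n) :=
  [set l2norm (A *m x) | x in [set x : 'cV[R[i]]_n | l2norm x <= 1]].

Let unit_image_ubound n (A : 'M[R[i]]_n) : has_ubound (unit_image A).
Proof.
exists (\sum_i \sum_j ComplexField.Normc.normc (A i j)) => _ [x x1 <-].
exact: l2norm_mulmx_le_sum.
Qed.

Lemma spectral_norm_ub n (A : 'M[R[i]]_n) (x : 'cV[R[i]]_n) : l2norm x <= 1 ->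
  l2norm (A *m x) <= spectral_norm A.
Proof. by move=> x1; apply: (ub_le_sup (unit_image_ubound A)); exists x. Qed.

Lemma spectral_norm_le n (A : 'M[R[i]]_n) (c : R) :
  (forall x : 'cV[R[i]]_n, l2norm x <= 1 -> l2norm (A *m x) <= c) ->
  spectral_norm A <= c.
Proof.
move=> Ac; apply: ge_sup => [|_ [x x1 <-]]; last exact: Ac.
by exists (l2norm (A *m 0)), 0 => //=; rewrite l2norm0.
Qed.

Lemma spectral_norm_ge0 n (A : 'M[R[i]]_n) : 0 <= spectral_norm A.
Proof.
rewrite -(l2norm0 n) -(mulmx0 _ A); apply: spectral_norm_ub.
by rewrite l2norm0.
Qed.

Lemma spectral_norm_dist_le n (A B : 'M[R[i]]_n) :
  `|spectral_norm A - spectral_norm B| <=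
  \sum_i \sum_j (`|complex.Re (A i j) - complex.Re (B i j)| +
                 `|complex.Im (A i j) - complex.Im (B i j)|).
Proof.
have H (C D : 'M[R[i]]_n) : spectral_norm C <= spectral_norm D +
  \sum_i \sum_j (`|complex.Re (C i j) - complex.Re (D i j)| +
                 `|complex.Im (C i j) - complex.Im (D i j)|).
  apply: spectral_norm_le => x x1.
  have -> : C *m x = D *m x + (C - D) *m x by rewrite -mulmxDl addrC subrK.
  rewrite (le_trans (l2normD _ _))// lerD//.
    exact: spectral_norm_ub.
  rewrite (le_trans (l2norm_mulmx_le_sum _ x1))// ler_sum// => i _.
  rewrite ler_sum// => j _; rewrite (le_trans (normc_le_ReIm _))// !mxE.
  case: (C i j) (D i j) => [a b] [c d] /=.
  by rewrite lexx.
rewrite ler_distl H andbT lerBlDr (le_trans (H B A))// lerD2l.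
rewrite ler_sum// => i _; rewrite ler_sum// => j _.
by rewrite distrC lerD2l distrC.
Qed.

End SpectralNorm.

(** * Comparison of real functions *)

Section ScalarComparison.
Context {R : realType}.
Implicit Types (f g G : R -> R) (S : seq R).

(** Induction on the exceptional points: one that lies inside the interval splits it in two, and
    continuity joins the halves; one outside is discarded. *)
Lemma ger0_derive1_le_except f (a b : R) S : a <= b ->
  {within `[a, b], continuous f} ->
  (forall x, x \in `]a, b[ -> x \notin S -> derivable f x 1 /\ 0 <= derive1 f x) ->
  f a <= f b.
Proof.
elim: S a b => [a b ab cf df|s S IH a b ab cf df].
  apply: (@ger0_derive1_le_cc _ f a b) => // [x|x||].
  - by move=> /df[].
  - by move=> /df[].
  - by rewrite in_itv/= lexx.
  - by rewrite in_itv/= lexx ab.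
have [/andP[as_ sb]|nsab] := boolP (a < s < b); last first.
  apply: IH => // x xab xS; apply: df => //; rewrite inE negb_or xS andbT.
  by apply: contraNneq nsab => <-; move: xab; rewrite in_itv.
apply: (@le_trans _ _ (f s)); apply: IH; try exact: ltW.
- apply: continuous_subspaceW cf => x /=; rewrite !in_itv/= => /andP[-> xs] /=.
  exact: le_trans xs (ltW sb).
- move=> x; rewrite in_itv/= => /andP[ax xs] xS; apply: df.
    by rewrite in_itv/= ax (lt_trans xs).
  by rewrite inE negb_or xS andbT lt_eqF.
- apply: continuous_subspaceW cf => x /=; rewrite !in_itv/= => /andP[sx ->].
  by rewrite andbT (le_trans (ltW as_)).
- move=> x; rewrite in_itv/= => /andP[sx xb] xS; apply: df.
    by rewrite in_itv/= xb (lt_trans as_).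
  by rewrite inE negb_or xS andbT gt_eqF.
Qed.

(* The shrinking factor r keeps r * y away from the endpoints of [-1, 1], where
   acos is not differentiable. *)
Lemma cos_le_of_acos (y L : R) : -1 <= y <= 1 -> 0 <= L <= pi ->
  (forall r, 0 < r < 1 -> acos (r * y) <= L + acos r) -> cos L <= y.
Proof.
move=> y11 /andP[L0 Lpi] H; rewrite leNgt; apply/negP => yL.
have yitv : y \in `[(-1), 1] by rewrite in_itv.
have cosy : cos (acos y) = y by exact: acosK.
have ay0 : 0 <= acos y by exact: acos_ge0.
have aypi : acos y <= pi by exact: acos_lepi.
have Lay : L < acos y.
  rewrite -(@ltr_cos R) ?in_itv/= ?L0 ?ay0 ?Lpi ?aypi// cosy//.
(* With [r = cos d], the hypothesis gives an angle of at most [L + d], that is [acos y - 2 * d]. A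
   third of the gap keeps [d] below [pi / 2], so that [r] is positive. *)
set d := (acos y - L) / 3.
have d0 : 0 < d by rewrite /d; lra.
have dpi : d < pi / 2 by rewrite /d; have := pi_gt0 R; lra.
have d_itv : d \in `[0, pi] by rewrite in_itv/=; apply/andP; split; lra.
have r0 : 0 < cos d by rewrite cos_gt0_pihalf//; apply/andP; split; lra.
have r1 : cos d < 1.
  by rewrite -(cos0 R) ltr_cos// in_itv/= lexx pi_ge0.
have := H _ (introT andP (conj r0 r1)); rewrite cosK// => Hd.
have ry_itv : cos d * y \in `[(-1), 1].
  rewrite in_itv/= -ler_norml normrM -[leRHS]mulr1 ler_pM ?cos_max//.
  by rewrite ler_norml.
have : acos (cos d * y) < acos y - d by rewrite /d in Hd *; lra.
rewrite -(@ltr_cos R) ?in_itv/= ?acos_ge0 ?acos_lepi//; last first.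
  by apply/andP; split; rewrite /d; lra.
(* Contradiction: [cos (acos y - d)] is [y * cos d] plus a product of two nonnegative sines. *)
rewrite acosK// cosB cosy ltNge => /negP; apply.
rewrite mulrC lerDl mulr_ge0 ?sin_ge0_pi ?ay0 ?aypi//.
Qed.

Lemma is_derive_acos_comp f (t r df : R) : -1 < r * f t < 1 ->
  is_derive t 1 f df ->
  is_derive t 1 (fun s => acos (r * f s))
    (- (r * df / Num.sqrt (1 - (r * f t) ^+ 2))).
Proof.
move=> rf Df.
have D1 : is_derive t 1 (fun s => r * f s) (r * df) by exact: is_deriveZ.
have D2 := is_derive1_acos rf.
have := @is_derive1_comp R (@acos R) (fun s => r * f s) t _ _ D2 D1.
by rewrite /= => D3; apply: is_derive_eq; rewrite mulNr mulrC.
Qed.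

(* acos (r * f) - acos r has slope at most that of G: for |y| <= 1 and r < 1,
   r sqrt (1 - y^2) <= sqrt (1 - (r y)^2). *)
Lemma cos_increment_le f G (s t : R) S : s <= t ->
  {within `[s, t], continuous f} -> {within `[s, t], continuous G} ->
  (forall x, x \in `[s, t] -> -1 <= f x <= 1) ->
  (forall x, x \in `]s, t[ -> x \notin S ->
    exists df dG, [/\ is_derive x 1 f df, is_derive x 1 G dG, 0 <= dG &
      `|df| <= dG * Num.sqrt (1 - f x ^+ 2)]) ->
  f s = 1 -> G t - G s <= pi -> cos (G t - G s) <= f t.
Proof.
move=> st cf cG f11 dfG fs Gpi.
have s_itv : s \in `[s, t] by rewrite in_itv/= lexx.
have t_itv : t \in `[s, t] by rewrite in_itv/= lexx st.
have Gst : G s <= G t.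
  apply: (ger0_derive1_le_except (S := S)) => // x xst xS.
  by have [df [dG [_ [dGx <-] dG0 _]]] := dfG _ xst xS; rewrite derive1E.
apply: cos_le_of_acos; [exact: f11|by rewrite subr_ge0 Gst|].
move=> r /andP[r0 r1].
have rf x : x \in `[s, t] -> -1 < r * f x < 1.
  move=> /f11 /andP[fx1 fx2]; apply/andP; split; nra.
(* As [f s = 1], the claim for [r] says that [G - acos (r * f)] does not decrease from [s] to
   [t]. *)
suff : G s - acos (r * f s) <= G t - acos (r * f t) by rewrite fs mulr1; lra.
apply: (@ger0_derive1_le_except (fun x => G x - acos (r * f x)) s t S) => //.
  apply: within_continuousB => //; apply/subspace_continuousP => x xst.
  apply: (cvg_comp (fun y => r * f y)).
    by apply: cvgZ; [exact: cvg_cst|move/subspace_continuousP: cf; exact].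
  exact/continuous_acos/rf.
move=> x xst xS; have xcc : x \in `[s, t] by apply: subset_itv_oo_cc.
have [df [dG [Df DG dG0 dfdG]]] := dfG _ xst xS.
have DH := is_deriveB DG (is_derive_acos_comp (rf _ xcc) Df).
split; first exact: ex_derive.
rewrite derive1E; rewrite derive_val.
rewrite opprK -lerBlDr sub0r.
have q0 : 0 < 1 - (r * f x) ^+ 2.
  by have /andP[] := rf _ xcc; nra.
have p0 : 0 <= 1 - f x ^+ 2 by have /andP[] := f11 _ xcc; nra.
apply: (@le_trans _ _ (`|df| * r / Num.sqrt (1 - (r * f x) ^+ 2))).
  have -> q : - (r * df / q) = - df * (r / q) by ring.
  by rewrite -mulrA ler_wpM2r ?divr_ge0 ?sqrtr_ge0 ?(ltW r0)// -normrN ler_norm.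
rewrite ler_pdivrMr ?sqrtr_gt0//.
apply: (@le_trans _ _ (dG * Num.sqrt (1 - f x ^+ 2) * r)); first by rewrite ler_pM2r.
rewrite -mulrA ler_wpM2l// -[X in _ * X]ger0_norm ?(ltW r0)// -sqrtr_sqr -sqrtrM//.
by rewrite ler_wsqrtr//; nra.
Qed.
End ScalarComparison.

(** * Smooth functions of one real variable *)

Section SmoothFunctions.
Context {R : realType}.
Implicit Types (f g : R -> R).

(** Coinduction: a class of differentiable functions closed under differentiation consists of smooth
    functions, so no iterated derivative has to be computed. *)
Lemma smooth_coind (K : (R -> R) -> Prop) :
  (forall f, K f -> (forall t, derivable f t 1) /\ K (derive1 f)) ->
  forall f, K f -> smooth f.
Proof.
move=> HK f Kf k; suff Kk : K (derive1n k f) by have [] := HK _ Kk.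
by elim: k => // k Kk; rewrite derive1nS; have [] := HK _ Kk.
Qed.

Lemma smooth_derivable f (t : R) : smooth f -> derivable f t 1.
Proof. by move=> /(_ 0%N t). Qed.

Lemma smooth_derive1 f : smooth f -> smooth (derive1 f).
Proof.
move=> sf k t; have := sf k.+1 t.
by rewrite /derive1n iterSr.
Qed.

Lemma smooth_continuous f : smooth f -> continuous f.
Proof. by move=> sf t; apply/differentiable_continuous/derivable1_diffP/smooth_derivable. Qed.

Lemma is_derive_smooth f (t : R) : smooth f -> is_derive t 1 f (derive1 f t).
Proof. by move=> sf; rewrite derive1E; apply/derivableP/smooth_derivable. Qed.

Lemma is_derive_lincomb (I : Type) (r : seq I) (c : I -> R) (f : I -> R -> R)
    (t : R) (df : I -> R) : (forall i, is_derive t 1 (f i) (df i)) ->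
  is_derive t 1 (fun s => \sum_(i <- r) c i * f i s) (\sum_(i <- r) c i * df i).
Proof.
move=> Df; elim: r => [|i r IH].
  by rewrite big_nil; under eq_fun do rewrite big_nil; exact: is_derive_cst.
rewrite big_cons; under eq_fun do rewrite big_cons.
by apply: is_deriveD; exact: is_deriveZ.
Qed.

Lemma smooth_lincomb (I : Type) (r : seq I) (c : I -> R) (f : I -> R -> R) :
  (forall i, smooth (f i)) -> smooth (fun t => \sum_(i <- r) c i * f i t).
Proof.
move=> sf; pose K h := exists g : I -> R -> R, (forall i, smooth (g i)) /\
  h = (fun t => \sum_(i <- r) c i * g i t).
apply: (@smooth_coind K); last by exists f.
move=> _ [g [sg ->]].
have Dg t := is_derive_lincomb r c (fun i => is_derive_smooth t (sg i)).
split=> [t|]; first exact: ex_derive.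
exists (fun i => derive1 (g i)); split=> [i|]; first exact: smooth_derive1.
by apply/funext => t; rewrite derive1E derive_val.
Qed.

Lemma is_derive_trig_poly (p r q : {poly R}) (t : R) :
  is_derive t 1 (fun s => p.[s] * cos q.[s] + r.[s] * sin q.[s])
    ((deriv p + r * deriv q).[t] * cos q.[t] +
     (deriv r - p * deriv q).[t] * sin q.[t]).
Proof.
have Dc := @is_derive1_comp R (@cos R) (horner q) t _ _ (is_derive_cos _) (is_derive_poly q t).
have Ds := @is_derive1_comp R (@sin R) (horner q) t _ _ (is_derive_sin _) (is_derive_poly q t).
have := is_deriveD (is_deriveM (is_derive_poly p t) Dc) (is_deriveM (is_derive_poly r t) Ds).
move=> D; apply: is_derive_eq; rewrite !hornerE /= /GRing.scale /=; ring.
Qed.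

(** For fixed [q] these functions form a class closed under differentiation. The entries of
    [phase_diag] below belong to it. *)
Lemma smooth_trig_poly (p r q : {poly R}) :
  smooth (fun t => p.[t] * cos q.[t] + r.[t] * sin q.[t]).
Proof.
pose K h := exists p r : {poly R},
  h = (fun t => p.[t] * cos q.[t] + r.[t] * sin q.[t]).
apply: (@smooth_coind K); last by exists p, r.
move=> _ [p' [r' ->]]; have D := is_derive_trig_poly p' r' q.
split=> [t|]; first exact: ex_derive.
exists (deriv p' + r' * deriv q), (deriv r' - p' * deriv q).
by apply/funext => t; rewrite derive1E derive_val.
Qed.

End SmoothFunctions.

(** * Integrals and primitives of functions continuous off a finite set *)

Section Primitive.
Context {R : realType}.
Variables (v : R -> R) (S : seq R).
Hypothesis v_cont : forall x : R, x \in `]0, 1[ -> x \notin S -> {for x, continuous v}.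
Local Notation mu := (@lebesgue_measure R).

Lemma finite_exception_measurable : measurable_fun (`[0%R, 1%R] : set R) v.
Proof.
(* The endpoints join the exceptional points, since continuity is assumed inside the interval only.
   Off [F] the set is open and [v] is continuous on it; inside [F] every set is finite. *)
set F : set R := [set` [:: 0, 1 & S]].
have fin_meas (A : set R) : A `<=` F -> measurable A.
  move=> AF; apply: countable_measurable => //.
  by apply/finite_set_countable/(sub_finite_set AF)/finite_seq.
have oO : open (`]0%R, 1%R[ `\` F : set R).
  rewrite setDE; apply: openI => //; apply/closed_openC.
  by apply: (accessible_finite_set_closed.1 _ _ (finite_seq _)); exact: hausdorff_accessible.
have -> : [set` `[0%R, 1%R]] = ([set` `]0, 1[] `\` F) `|` (F `&` [set` `[0, 1]]).
  apply/seteqP; split=> x /=; last first.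
    by case=> [[x01 _]|[]//]; apply: subset_itv_oo_cc.
  move=> x01; have [xF|xF] := boolP (x \in [:: 0, 1 & S]); first by right.
  left; split; last exact/negP.
  move: x01 xF; rewrite !in_itv/= !inE !negb_or => /andP[x0 x1] /and3P[x0' x1' _].
  by rewrite lt_neqAle eq_sym x0' x0 lt_neqAle x1' x1.
apply/measurable_funU.
- exact: open_measurable.
- exact: fin_meas.
- split; last by move=> _ Y _; apply: fin_meas => x [[]].
  apply: open_continuous_measurable_fun => // x; rewrite inE => -[/= x01 xF].
  apply: v_cont => //; move/negP: xF; rewrite !inE !negb_or; by case/and3P.
Qed.

Lemma finite_exception_integral_cst (c : R) :
  (forall x : R, x \in `]0, 1[ -> x \notin S -> v x = c) ->
  (\int[mu]_(t in `[0%R, 1%R]) (v t)%:E = c%:E)%E.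
Proof.
move=> vc; have -> : c%:E = (\int[mu]_(t in `[0%R, 1%R]) (cst c%:E) t)%E.
  by rewrite integral_cst//= lebesgue_measure_itv/= lte_fin ltr01 oppr0 adde0 mule1.
apply: ae_eq_integral => //.
  by apply/measurable_EFinP; exact: finite_exception_measurable.
exists [set` [:: 0, 1 & S]]; split.
- by apply: countable_measurable => //; exact/finite_set_countable/finite_seq.
- exact/countable_lebesgue_measure0/finite_set_countable/finite_seq.
- move=> x /= /not_implyP[x01 vxc]; apply: contrapT => /negP xS; apply: vxc.
  move: x01 xS; rewrite in_itv/= !inE !negb_or => /andP[x0 x1] /and3P[x0' x1' xS].
  congr EFin; apply: vc => //.
  by rewrite in_itv/= lt_neqAle eq_sym x0' x0 lt_neqAle x1' x1.
Qed.

Hypothesis v_ge0 : forall x, 0 <= v x.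
Hypothesis v_fin : (\int[mu]_(t in `[0%R, 1%R]) (v t)%:E < +oo)%E.

(** For [v] the speed of a curve, this expresses the length as the increment of a continuous [G]
    whose derivative is the speed off the breakpoints. [G] is the integral from 0, by the
    fundamental theorem at points of continuity. *)
Lemma finite_exception_primitive : exists G : R -> R,
  [/\ {within `[0, 1], continuous G},
      forall x : R, x \in `]0, 1[ -> x \notin S -> is_derive x 1 G (v x) &
      ((G 1 - G 0)%:E = \int[mu]_(t in `[0%R, 1%R]) (v t)%:E)%E].
Proof.
have v_int : mu.-integrable `[0, 1] (EFin \o v).
  apply/integrableP; split; first by apply/measurable_EFinP; exact: finite_exception_measurable.
  rewrite (le_lt_trans _ v_fin)// le_eqVlt; apply/orP; left; apply/eqP.
  by apply: eq_integral => x _; rewrite /= ger0_norm.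
exists (fun x => parameterized_integral mu 0 x v); split.
- exact: parameterized_integral_continuous.
- move=> x /[dup] x01; rewrite in_itv/= => /andP[x0 x1] xS.
  have [D <-] := continuous_FTC1_closed x1 v_int x0 (v_cont x01 xS).
  by rewrite derive1E; exact/derivableP.
- rewrite /parameterized_integral set_itv1 Rintegral_set1 subr0 /Rintegral fineK//.
  exact: integrable_fin_num.
Qed.

End Primitive.
(** * Piecewise smooth curves of matrices *)

Section RealLinearFunctionals.
Context {R : realType} {n : nat}.
Implicit Types (a g : R -> 'M[R[i]]_n) (l : 'M[R[i]]_n -> R).

(** Linearity over the reals only, so that real parts, imaginary parts and [rdot] qualify. *)
Definition real_linear l : Prop :=
  (forall A B : 'M[R[i]]_n, l (A + B) = l A + l B) /\
  (forall (r : R) (A : 'M[R[i]]_n), l (r%:C *: A) = r * l A).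

Definition real_coord (p : bool * ('I_n * 'I_n)) (A : 'M[R[i]]_n) : R :=
  if p.1 then complex.Re (A p.2.1 p.2.2) else complex.Im (A p.2.1 p.2.2).

Definition real_basis (p : bool * ('I_n * 'I_n)) : 'M[R[i]]_n :=
  (if p.1 then 1 else 'i%C) *: delta_mx p.2.1 p.2.2.

(** Matrix units and their multiples by ['i] form a real basis. Derivatives, smoothness and
    continuity of [l \o a] thus reduce to the real and imaginary parts of the entries. *)
Lemma real_linear_coord l A : real_linear l ->
  l A = \sum_p l (real_basis p) * real_coord p A.
Proof.
move=> [lD lZ].
have l0 : l 0 = 0 by rewrite -(scale0r 0) -(rmorph0 (real_complex R)) lZ mul0r.
have l_sum (I : Type) (r : seq I) (F : I -> 'M[R[i]]_n) :
    l (\sum_(i <- r) F i) = \sum_(i <- r) l (F i).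
  by elim/big_rec2: _ => // i y x _ <-; rewrite lD.
have AE : A = \sum_p (real_coord p A)%:C *: real_basis p.
  rewrite -(pair_bigA _ (fun b ij => (real_coord (b, ij) A)%:C *: real_basis (b, ij))).
  rewrite exchange_big /= -(pair_bigA _ (fun i j =>
    \sum_(b : bool) (real_coord (b, (i, j)) A)%:C *: real_basis (b, (i, j)))) /=.
  rewrite {1}(matrix_sum_delta A); apply: eq_bigr => i _; apply: eq_bigr => j _.
  rewrite big_bool /real_coord /real_basis /= !scalerA -scalerDl mulr1.
  by rewrite {1}(complexE (A i j)) [X in _ + X]mulrC.
by rewrite {1}AE l_sum; apply: eq_bigr => p _; rewrite lZ mulrC.
Qed.

Lemma real_linear_comp l a : real_linear l ->
  l \o a = fun s => \sum_p l (real_basis p) * real_coord p (a s).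
Proof. by move=> ll; apply/funext => s; exact: real_linear_coord. Qed.

Lemma is_derive_real_linear l a (t : R) : real_linear l -> mx_derivable a t ->
  is_derive t 1 (l \o a) (l (velocity a t)).
Proof.
move=> ll Da; rewrite (real_linear_comp a ll).
rewrite (real_linear_coord (velocity a t) ll).
apply: is_derive_lincomb => -[b [i j]]; have [Dre Dim] := Da i j.
by case: b; rewrite /real_coord /= mxE /= derive1E; exact/derivableP.
Qed.

Lemma smooth_real_linear l a : real_linear l -> mx_smooth a -> smooth (l \o a).
Proof.
move=> ll sa; rewrite (real_linear_comp a ll).
by apply: smooth_lincomb => -[b [i j]]; have [] := sa i j; case: b.
Qed.

Lemma within_continuous_real_linear l a (A : set R) : real_linear l ->
  (forall i j, {within A, continuous (entry_re a i j)} /\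
               {within A, continuous (entry_im a i j)}) ->
  {within A, continuous (l \o a)}.
Proof.
move=> ll ca; rewrite (real_linear_comp a ll).
elim: (index_enum _) => [|p r IH].
  under eq_fun do rewrite big_nil; exact/continuous_subspaceT/cst_continuous.
under eq_fun do rewrite big_cons; apply: within_continuousD => //.
move=> x; apply: cvgZ; first exact: cvg_cst.
by case: p => -[] [i j]; have [cre cim] := ca i j; [exact: cre|exact: cim].
Qed.

Lemma real_linear_rdot (y x : 'cV[R[i]]_n) : real_linear (fun A => rdot y (A *m x)).
Proof.
split=> [A B|r A]; first by rewrite mulmxDl rdotDr.
by rewrite -scalemxAl rdotZr.
Qed.

Lemma is_derive_rdot a (y x : 'cV[R[i]]_n) (t : R) : mx_derivable a t ->
  is_derive t 1 (fun s => rdot y (a s *m x)) (rdot y (velocity a t *m x)).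
Proof. exact: (is_derive_real_linear (real_linear_rdot y x)). Qed.

Lemma real_linear_Re (A B : 'M[R[i]]_n) i j :
  real_linear (fun M => complex.Re ((A *m M *m B) i j)).
Proof.
split=> [M N|r M]; first by rewrite mulmxDr mulmxDl mxE ReD.
by rewrite -scalemxAr -scalemxAl mxE Re_scale.
Qed.

Lemma real_linear_Im (A B : 'M[R[i]]_n) i j :
  real_linear (fun M => complex.Im ((A *m M *m B) i j)).
Proof.
split=> [M N|r M]; first by rewrite mulmxDr mulmxDl mxE ImD.
by rewrite -scalemxAr -scalemxAl mxE Im_scale.
Qed.

Lemma mx_smooth_mulmx a (A B : 'M[R[i]]_n) : mx_smooth a ->
  mx_smooth (fun t => A *m a t *m B).
Proof.
move=> sa i j; split; first exact: (smooth_real_linear (real_linear_Re A B i j) sa).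
exact: (smooth_real_linear (real_linear_Im A B i j) sa).
Qed.

Lemma velocity_mulmx a (A B : 'M[R[i]]_n) t : mx_derivable a t ->
  velocity (fun t => A *m a t *m B) t = A *m velocity a t *m B.
Proof.
move=> Da; apply/matrixP => i j; rewrite mxE !derive1E.
have Dre := is_derive_real_linear (real_linear_Re A B i j) Da.
have Dim := is_derive_real_linear (real_linear_Im A B i j) Da.
rewrite (@derive_val _ _ _ _ _ _ _ Dre) (@derive_val _ _ _ _ _ _ _ Dim).
by case: (_ i j).
Qed.

End RealLinearFunctionals.

(** * From partitions to local smoothness off finitely many points *)

Section PiecewiseSmoothCurves.
Context {R : realType}.
Implicit Types (n : nat) (S : seq R).

(** Agreement with [g] on a whole neighbourhood lets velocities, and their continuity, pass from [g]
    to [a]. *)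
Definition smooth_off n (a : R -> 'M[R[i]]_n) S : Prop :=
  forall t, t \in `]0, 1[ -> t \notin S ->
    exists g : R -> 'M[R[i]]_n, mx_smooth g /\ \forall s \near t, a s = g s.

Definition entries_continuous n (a : R -> 'M[R[i]]_n) : Prop := forall i j,
  {within `[0, 1], continuous (entry_re a i j)} /\
  {within `[0, 1], continuous (entry_im a i j)}.

(** Continuity glues along two closed sets; the first piece is split off and the rest follows by
    induction. *)
Lemma itv_partition_continuous (f : R -> R) (a : R) S : path <%R a S ->
  (forall k, (k < size S)%N ->
    {within `[nth 0 (a :: S) k, nth 0 (a :: S) k.+1], continuous f}) ->
  {within `[a, last a S], continuous f}.
Proof.
elim: S a => [a _ _|x S IH a /= /andP[ax xS] cf].
  by rewrite set_itv1; exact: continuous_subspace1.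
have -> : `[a, last x S]%classic = `[a, x] `|` `[x, last x S].
  apply/seteqP; split=> t /=.
    rewrite !in_itv/= => /andP[at_ ->]; rewrite at_ andbT /=.
    by case: (leP t x) => [|/ltW]; [left|right].
  have xl : x <= last x S.
    by apply: (itv_partition_le (s := S)); split.
  rewrite !in_itv/= => -[/andP[-> tx]|/andP[xt ->]].
    by rewrite (le_trans tx).
  by rewrite (le_trans (ltW ax)).
apply: withinU_continuous; [exact: interval_closed|exact: interval_closed|..].
  exact: (cf 0%N).
by apply: IH => // k kS; exact: (cf k.+1).
Qed.

Lemma itv_partition_locate (a t : R) S : path <%R a S ->
  a < t -> t < last a S -> t \notin S ->
  exists2 k, (k < size S)%N & nth 0 (a :: S) k < t < nth 0 (a :: S) k.+1.
Proof.
elim: S a => [a _ /= at_ ta _|x S IH a /= /andP[ax xS] at_ tl].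
  by have := lt_trans at_ ta; rewrite ltxx.
rewrite inE negb_or => /andP[tx tS].
have [xt|xt|xt] := ltgtP x t; last by rewrite xt eqxx in tx.
  by have [k kS kt] := IH x xS xt tl tS; exists k.+1.
by exists 0%N => //=; rewrite at_.
Qed.

(** Replaces the partition by the two facts that the estimates work with. A point that is no
    breakpoint is interior to some piece, where [a] agrees with the smooth extension. *)
Lemma piecewise_smooth_off n (a : R -> 'M[R[i]]_n) : piecewise_smooth a ->
  entries_continuous a /\ exists S, smooth_off a S.
Proof.
case=> S [[pS /eqP lastS] ag]; split.
  have cS (f : R -> R) : (forall k, (k < size S)%N ->
      {within `[nth 0 (0 :: S) k, nth 0 (0 :: S) k.+1], continuous f}) ->
      {within `[0, 1], continuous f}.
    by move=> cf; have := itv_partition_continuous pS cf; rewrite lastS.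
  move=> i j; split; apply: cS => k kS; have [g [sg ag_eq]] := ag k kS;
    have [sre sim] := sg i j.
    apply: (@subspace_eq_continuous _ _ _ (entry_re g i j)).
      by move=> x; rewrite inE/= => xk; rewrite /from_subspace /entry_re ag_eq.
    exact/continuous_subspaceT/smooth_continuous.
  apply: (@subspace_eq_continuous _ _ _ (entry_im g i j)).
    by move=> x; rewrite inE/= => xk; rewrite /from_subspace /entry_im ag_eq.
  exact/continuous_subspaceT/smooth_continuous.
exists S => t; rewrite in_itv/= => /andP[t0 t1] tS.
have [|k kS kt] := itv_partition_locate pS t0 _ tS; first by rewrite lastS.
have [g [sg ag_eq]] := ag k kS; exists g; split=> //.
have := near_in_itvoo (_ : t \in `]nth 0 (0 :: S) k, nth 0 (0 :: S) k.+1[).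
rewrite in_itv/= => /(_ kt); apply: filterS => s s_itv.
by apply: ag_eq; apply: subset_itv_oo_cc.
Qed.

Lemma mx_smooth_derivable n (g : R -> 'M[R[i]]_n) t : mx_smooth g -> mx_derivable g t.
Proof. by move=> sg i j; have [] := sg i j; split; exact: smooth_derivable. Qed.

Lemma near_eq_mx_derivable n (a g : R -> 'M[R[i]]_n) (t : R) :
  (\forall s \near t, a s = g s) -> mx_derivable g t ->
  mx_derivable a t /\ velocity a t = velocity g t.
Proof.
move=> ag Dg.
have agre i j : \forall s \near t, entry_re g i j s = entry_re a i j s.
  by apply: filterS ag => s; rewrite /entry_re => ->.
have agim i j : \forall s \near t, entry_im g i j s = entry_im a i j s.
  by apply: filterS ag => s; rewrite /entry_im => ->.
split.
  by move=> i j; have [Dre Dim] := Dg i j; split;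
     [exact: (near_eq_derivable (agre i j))|exact: (near_eq_derivable (agim i j))].
apply/matrixP => i j; rewrite !mxE !derive1E.
by rewrite (near_eq_derive (1 : R) (agre i j)) (near_eq_derive (1 : R) (agim i j)).
Qed.

(** The spectral norm is Lipschitz in the entries, and the entries of the velocity are
    continuous. *)
Lemma smooth_speed_continuous n (g : R -> 'M[R[i]]_n) : mx_smooth g ->
  continuous (fun t => spectral_norm (velocity g t)).
Proof.
move=> sg t.
pose d s : R := \sum_i \sum_j
  (`|derive1 (entry_re g i j) t - derive1 (entry_re g i j) s| +
   `|derive1 (entry_im g i j) t - derive1 (entry_im g i j) s|).
have dt : d t = 0.
  by rewrite /d big1// => i _; rewrite big1// => j _; rewrite !subrr normr0 addr0.
have cd : d s @[s --> t] --> 0.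
  have c1 (f : R -> R) : smooth f ->
      `|derive1 f t - derive1 f s| @[s --> t] --> `|derive1 f t - derive1 f t|.
    move=> sf; apply: cvg_norm; apply: cvgB; first exact: cvg_cst.
    exact/smooth_continuous/smooth_derive1.
  rewrite -dt /d; apply: cvg_big => [|i _]; first exact: add_continuous.
  apply: cvg_big => [|j _]; first exact: add_continuous.
  by have [sre sim] := sg i j; apply: cvgD; exact: c1.
apply/cvgrPdist_le => e e0; near=> s.
apply: (le_trans (spectral_norm_dist_le _ _)).
have -> : \sum_i \sum_j
    (`|complex.Re (velocity g t i j) - complex.Re (velocity g s i j)| +
     `|complex.Im (velocity g t i j) - complex.Im (velocity g s i j)|) = d s.
  by apply: eq_bigr => i _; apply: eq_bigr => j _; rewrite !mxE.
apply: (le_trans (ler_norm _)); rewrite -normrN -sub0r.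
by near: s; move/cvgrPdist_le: cd; exact.
Unshelve. all: by end_near. Qed.

Lemma smooth_off_speed_continuous n (a : R -> 'M[R[i]]_n) S (t : R) : smooth_off a S ->
  t \in `]0, 1[ -> t \notin S ->
  {for t, continuous (fun s => spectral_norm (velocity a s))}.
Proof.
move=> aS t01 tS; have [g [sg ag]] := aS t t01 tS.
have eq_near : \forall s \near t,
    spectral_norm (velocity g s) = spectral_norm (velocity a s).
  (* Equality at points near [t] is not enough for velocities: [a] and [g] must agree near each such
     [s]. *)
  move/near_join: ag; apply: filterS => s ag.
  by have [_ ->] := near_eq_mx_derivable ag (mx_smooth_derivable s sg).
rewrite /continuous_at /prop_for -(nbhs_singleton eq_near).
by apply: (cvg_trans _ (smooth_speed_continuous sg (x := t))); exact: near_eq_cvg.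
Qed.

Lemma smooth_off_derivable n (a : R -> 'M[R[i]]_n) S (t : R) : smooth_off a S ->
  t \in `]0, 1[ -> t \notin S -> mx_derivable a t.
Proof.
move=> aS t01 tS; have [g [sg ag]] := aS t t01 tS.
by have [] := near_eq_mx_derivable ag (mx_smooth_derivable t sg).
Qed.

End PiecewiseSmoothCurves.

(** * Orbits of unit vectors on the sphere *)

Section SphereSpeed.
Context {R : realType} {n : nat}.
Variables (a : R -> 'M[R[i]]_n) (S : seq R).
Hypothesis aS : smooth_off a S.
Hypothesis unitary_a : {in `[0, 1], forall t, a t \is unitarymx}.

Let unit_orbit (x : 'cV[R[i]]_n) (t : R) : l2norm x = 1 -> t \in `[0, 1] ->
  l2norm (a t *m x) = 1.
Proof. by move=> x1 t01; rewrite l2norm_unitary// unitary_a. Qed.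

(* s |-> rdot (a t x) (a s x) is at most 1, with equality at s = t. *)
Lemma rdot_orbit_velocity (x : 'cV[R[i]]_n) (t : R) : l2norm x = 1 ->
  t \in `]0, 1[ -> t \notin S -> rdot (a t *m x) (velocity a t *m x) = 0.
Proof.
move=> x1 t01 tS; have t01' : t \in `[0, 1] by exact: subset_itv_oo_cc.
have [g [sg ag]] := aS t01 tS.
have Da := smooth_off_derivable aS t01 tS.
have : \forall s \near t, a s = g s /\ s \in `[0, 1].
  apply: filterS2 ag (near_in_itvoo t01) => s -> s01.
  by split=> //; exact: subset_itv_oo_cc.
move=> /nbhs_ballP[e /= e0 tes].
have in_ball s : s \in `]t - e, t + e[ -> a s = g s /\ s \in `[0, 1].
  by move=> s_itv; apply: tes; rewrite /ball/= distrC ltr_distl; move: s_itv; rewrite in_itv.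
(* The maximum principle is applied with [g], which is differentiable everywhere, on an interval
   where it agrees with [a]. *)
pose f s := rdot (a t *m x) (g s *m x).
have Df s : derivable f s 1.
  by have [] := is_derive_rdot (a t *m x) x (mx_smooth_derivable s sg).
have te : t - e <= t + e by lra.
have t_itv : t \in `]t - e, t + e[ by rewrite in_itv/= ltrBlDr ltrDl e0.
have f_max s : s \in `]t - e, t + e[ -> f s <= f t.
  move=> /in_ball[ags s01]; rewrite /f -ags -(in_ball t t_itv).1.
  have /l2norm1P -> := unit_orbit x1 t01'.
  by apply: le_trans (ler_norm _) _; apply: rdot_le1; exact: unit_orbit.
have D0 := derive1_at_max te (fun s _ => Df s) t_itv f_max.
have D1 := is_derive_rdot (a t *m x) x Da.
rewrite -(@derive_val _ _ _ _ _ _ _ D1) -[RHS](@derive_val _ _ _ _ _ _ _ D0).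
by apply: near_eq_derive; apply: filterS ag => s; rewrite /f => ->.
Qed.

(** The orbit's velocity is orthogonal to the orbit, so only the component [z] of [y] orthogonal to
    [a t *m x] contributes. Its norm is the square root, and Cauchy-Schwarz concludes. *)
Lemma rdot_orbit_slope (y x : 'cV[R[i]]_n) (t : R) : l2norm y = 1 -> l2norm x = 1 ->
  t \in `]0, 1[ -> t \notin S ->
  `|rdot y (velocity a t *m x)| <=
  spectral_norm (velocity a t) * Num.sqrt (1 - rdot y (a t *m x) ^+ 2).
Proof.
move=> y1 x1 t01 tS; set f := rdot y (a t *m x).
have t01' : t \in `[0, 1] by exact: subset_itv_oo_cc.
have /l2norm1P ax1 := unit_orbit x1 t01'; move/l2norm1P in y1.
pose z := y + - (f%:C *: (a t *m x)).
have -> : rdot y (velocity a t *m x) = rdot z (velocity a t *m x).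
  by rewrite /z rdotDl rdotNl rdotZl rdot_orbit_velocity// mulr0 oppr0 addr0.
have -> : Num.sqrt (1 - f ^+ 2) = l2norm z.
  rewrite l2normE /z rdotDl !rdotDr !rdotNl !rdotNr !rdotZl !rdotZr.
  by rewrite (rdotC (a t *m x) y) -/f ax1 y1; congr Num.sqrt; ring.
rewrite mulrC (le_trans (cauchy_schwarz _ _))// ler_wpM2l ?l2norm_ge0//.
by rewrite spectral_norm_ub// x1.
Qed.

(** The spherical distance between two points of an orbit is at most the increment of any [G]
    growing at least as fast as the curve moves; cosines reverse the inequality. *)
Lemma orbit_rdot_ge (G : R -> R) (x : 'cV[R[i]]_n) (s t : R) :
  entries_continuous a -> {within `[0, 1], continuous G} ->
  (forall u, u \in `]0, 1[ -> u \notin S -> exists2 dG, is_derive u 1 G dG &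
     spectral_norm (velocity a u) <= dG) ->
  l2norm x = 1 -> 0 <= s -> s <= t -> t <= 1 -> G t - G s <= pi ->
  cos (G t - G s) <= rdot (a s *m x) (a t *m x).
Proof.
move=> ca cG DG x1 s0 st t1 Gpi.
have sub01 u : u \in `[s, t] -> u \in `[0, 1].
  by rewrite !in_itv/= => /andP[su ut]; rewrite (le_trans s0)// (le_trans ut).
have s01 : s \in `[0, 1] by rewrite in_itv/= s0 (le_trans st).
have as1 := unit_orbit x1 s01.
apply: (@cos_increment_le R (fun u => rdot (a s *m x) (a u *m x)) G s t S) => //.
- apply: (@continuous_subspaceW _ _ [set` `[s, t]] [set` `[0, 1]]) => //.
  exact: (within_continuous_real_linear (real_linear_rdot (a s *m x) x) ca).
- by apply: continuous_subspaceW cG.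
- move=> u /sub01 u01; rewrite -ler_norml.
  exact: rdot_le1 as1 (unit_orbit x1 u01).
- move=> u ust uS.
  have u01 : u \in `]0, 1[.
    move: ust; rewrite !in_itv/= => /andP[su ut].
    by rewrite (le_lt_trans s0)// (lt_le_trans ut).
  have [dG DGu dG_ge] := DG u u01 uS.
  exists (rdot (a s *m x) (velocity a u *m x)), dG; split=> //.
  + exact/is_derive_rdot/(smooth_off_derivable aS).
  + exact: le_trans (spectral_norm_ge0 _) dG_ge.
  + by rewrite (le_trans (rdot_orbit_slope _ _ _ _))// ler_wpM2r ?sqrtr_ge0.
- by move/l2norm1P: as1.
Qed.

End SphereSpeed.
(** * Unitary matrices and their angles *)

Section UnitComplexNumbers.
Context {R : realType}.
Implicit Types (a b : R).

Lemma normc_cexpi a : ComplexField.Normc.normc (cexpi a) = 1.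
Proof. by rewrite /= cos2Dsin2 sqrtr1. Qed.

Lemma normc_iscale_cexpi (r a : R) :
  ComplexField.Normc.normc ((0 +i* r) * cexpi a) = `|r|.
Proof.
by rewrite ComplexField.Normc.normcM normc_cexpi mulr1 /= expr0n add0r sqrtr_sqr.
Qed.

Lemma cexpi0 : cexpi 0 = 1 :> R[i].
Proof. by rewrite /cexpi cos0 sin0. Qed.

Lemma conj_cexpi_mul a : (cexpi a : R[i])^* * cexpi a = 1.
Proof.
by apply/eqP; rewrite eq_complex /= mulNr opprK -!expr2 cos2Dsin2 mulrC mulNr subrr !eqxx.
Qed.

Lemma unit_complex_angle (z : R[i]) : ComplexField.Normc.normc z = 1 ->
  exists2 a, - pi < a <= pi & z = cexpi a.
Proof.
case: z => x y /= /(congr1 (fun r => r ^+ 2)); rewrite expr1n sqr_sqrtr ?addr_ge0 ?sqr_ge0//.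
move=> xy1; have x11 : -1 <= x <= 1.
  by rewrite -ler_norml -(expr_le1 (n := 2)) ?normr_ge0// real_normK ?num_real//; nra.
have cosx : cos (acos x) = x by apply: acosK; rewrite in_itv.
have sinx : sin (acos x) = `|y|.
  by rewrite sin_acos// -xy1 addrAC subrr add0r sqrtr_sqr.
have [y0|y0] := leP 0 y.
  exists (acos x); last by rewrite /cexpi cosx sinx ger0_norm.
  by rewrite acos_lepi// andbT (lt_le_trans _ (acos_ge0 x11))// oppr_lt0 pi_gt0.
exists (- acos x); last by rewrite /cexpi cosN sinN cosx sinx ltr0_norm// opprK.
(* If [x] were -1 then [y] would vanish; this keeps [- acos x] strictly above [- pi]. *)
have x_gtN1 : -1 < x.
  rewrite lt_neqAle (andP x11).1 andbT; apply/eqP => xN1.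
  move: xy1; rewrite -xN1 sqrrN expr1n => /eqP.
  by rewrite -subr_eq0 addrAC subrr add0r sqrf_eq0 lt_eqF.
rewrite ltrN2 acos_ltpi ?x_gtN1 ?(andP x11).2//=.
by rewrite (le_trans _ (pi_ge0 R))// oppr_le0 acos_ge0.
Qed.

(** Comparing real parts is enough: cosine is even and injective on [[0, pi]]. *)
Lemma cexpi_angle_norm a b : `|a| <= pi -> `|b| <= pi ->
  cexpi a = cexpi b \/ cexpi a = cexpi (- b) -> `|a| = `|b|.
Proof.
move=> api bpi ab; apply: (@cos_inj R); rewrite ?in_itv/= ?normr_ge0//.
by rewrite !cos_norm; case: ab => -[]; rewrite ?cosN.
Qed.

Lemma cexpi_neq a b : 0 < a - b <= pi -> cexpi a <> cexpi b.
Proof.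
move=> /andP[ab0 abpi] [cab sab].
have : cos (a - b) < cos 0.
  by rewrite ltr_cos// in_itv/= ?lexx ?pi_ge0// abpi ltW.
by rewrite cosB cab sab -!expr2 cos2Dsin2 cos0 ltxx.
Qed.

(* Writing sin T e^{iTt} = sin (T(1-t)) + sin (Tt) e^{iT} turns the two bounds
   from the endpoints into one for the point of the great circle at time t. *)
Lemma geodesic_point_le (T t A B : R) : 0 <= T < pi -> 0 <= t <= 1 ->
  cos (T * t) <= A -> cos (T * (1 - t)) <= cos T * A + sin T * B ->
  1 <= cos (T * t) * A + sin (T * t) * B.
Proof.
move=> /andP[T0 Tpi] /andP[t0 t1] HA HB.
have [T_eq0|T_neq0] := eqVneq T 0.
  by move: HA; rewrite T_eq0 !mul0r cos0 sin0 mul0r addr0 mul1r.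
have sT : 0 < sin T by rewrite sin_gt0_pi// Tpi andbT lt_neqAle eq_sym T_neq0.
have s1 : 0 <= sin (T * t).
  by apply: sin_ge0_pi; rewrite mulr_ge0//= (le_trans _ (ltW Tpi))// ler_piMr.
have s2 : 0 <= sin (T * (1 - t)).
  apply: sin_ge0_pi; rewrite mulr_ge0 ?subr_ge0//=.
  by rewrite (le_trans _ (ltW Tpi))// ler_piMr// gerBl.
rewrite -(ler_pM2l sT) mulr1.
have E1 : sin (T * (1 - t)) = sin T * cos (T * t) - cos T * sin (T * t).
  by rewrite mulrBr mulr1 sinB.
have E2 : sin T = sin (T * (1 - t)) * cos (T * t) + sin (T * t) * cos (T * (1 - t)).
  have {1}-> : T = T * (1 - t) + T * t by ring.
  by rewrite sinD; ring.
(* Weighted by the two nonnegative sines, the left sides add up to [sin T] and the right sides to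
   [sin T] times the desired expression. *)
have H1 := ler_wpM2l s2 HA; have H2 := ler_wpM2l s1 HB.
rewrite {1}E2; apply: (le_trans (lerD H1 H2)); rewrite E1.
by rewrite le_eqVlt; apply/orP; left; apply/eqP; ring.
Qed.

End UnitComplexNumbers.

(** * Diagonalization of unitary matrices *)

Section DiagonalUnitary.
Context {R : realType}.
Implicit Types n : nat.

Lemma l2norm_diag_le n (d : 'rV[R[i]]_n) (c : R) (x : 'cV[R[i]]_n) : 0 <= c ->
  (forall j, ComplexField.Normc.normc (d 0 j) <= c) ->
  l2norm (diag_mx d *m x) <= c * l2norm x.
Proof.
move=> c0 dc; rewrite -[X in X * _]ger0_norm// -sqrtr_sqr /l2norm -sqrtrM ?sqr_ge0//.
rewrite ler_wsqrtr// mulr_sumr ler_sum// => j _.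
rewrite mul_diag_mx mxE ComplexField.Normc.normcM exprMn ler_wpM2r ?sqr_ge0//.
by rewrite ler_pXn2r ?nnegrE ?normc_ge0.
Qed.

Lemma mul_diag_delta n (d : 'rV[R[i]]_n) j :
  diag_mx d *m delta_mx j 0 = d 0 j *: (delta_mx j 0 : 'cV_n).
Proof.
apply/colP => i; rewrite mul_diag_mx !mxE.
by case: eqVneq => [->|]; rewrite ?mulr0.
Qed.

(** Unitary factors preserve norms; the bound is attained at [B^t* *m delta_mx k 0]. The alternative
    [c = 0] covers dimension 0, where there is no index [k]. *)
Lemma spectral_norm_diag n (A B : 'M[R[i]]_n) (d : 'rV[R[i]]_n) (c : R) :
  A \is unitarymx -> B \is unitarymx -> 0 <= c ->
  (forall j, ComplexField.Normc.normc (d 0 j) <= c) ->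
  c = 0 \/ (exists k, ComplexField.Normc.normc (d 0 k) = c) ->
  spectral_norm (A *m diag_mx d *m B) = c.
Proof.
move=> uA uB c0 dc cmax; apply/le_anti/andP; split.
  apply: spectral_norm_le => x x1; rewrite -!mulmxA l2norm_unitary//.
  rewrite (le_trans (l2norm_diag_le _ c0 dc))// ler_piMr// l2norm_unitary//.
case: cmax => [->|[k <-]]; first exact: spectral_norm_ge0.
have B1 : l2norm (B^t* *m delta_mx k 0) = 1 by rewrite l2norm_unitaryC// l2norm_delta.
apply: le_trans (spectral_norm_ub _ (_ : l2norm (B^t* *m delta_mx k 0) <= 1)); last by rewrite B1.
rewrite -!mulmxA l2norm_unitary// [B *m _]mulmxA (unitarymxP uB) mul1mx.
by rewrite mul_diag_delta l2normZ l2norm_delta mulr1.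
Qed.

Lemma unitary_diag n (W : 'M[R[i]]_n) : W \is unitarymx ->
  exists (P : 'M[R[i]]_n) (theta : 'I_n -> R),
    [/\ P \is unitarymx, forall j, - pi < theta j <= pi &
      W = P^t* *m diag_mx (\row_j cexpi (theta j)) *m P].
Proof.
move=> uW; have nW : W \is normalmx.
  by apply/normalmxP; rewrite unitarymx_mulVmx// (unitarymxP uW).
have uP := spectral_unitarymx W.
have := orthomx_spectralP nW; rewrite (invmx_unitary uP).
move: (spectralmx W) (spectral_diag W) uP => P d uP WE.
(* The diagonal factor is [P *m W *m P^t*], hence an isometry, so its entries have modulus 1. *)
have d1 j : ComplexField.Normc.normc (d 0 j) = 1.
  have : l2norm (diag_mx d *m (delta_mx j 0 : 'cV_n)) = 1.
    have -> : diag_mx d = P *m W *m P^t*.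
      by rewrite WE !mulmxA (unitarymxP uP) mul1mx -mulmxA (unitarymxP uP) mulmx1.
    rewrite -!mulmxA (l2norm_unitary _ uP) (l2norm_unitary _ uW).
    by rewrite (l2norm_unitaryC _ uP) l2norm_delta.
  by rewrite mul_diag_delta l2normZ l2norm_delta mulr1.
have /choice[theta Htheta] : forall j, exists a : R, - pi < a <= pi /\ d 0 j = cexpi a.
  by move=> j; have [a] := unit_complex_angle (d1 j); exists a.
exists P, theta; split=> // [j|]; first by have [] := Htheta j.
have -> : \row_j cexpi (theta j) = d; last exact: WE.
by apply/rowP => j; rewrite mxE; have [] := Htheta j.
Qed.

(** [eigenvalue] refers to row eigenvectors: [v] is transported to [v *m P^t*], and conversely the
    rows of [P] are eigenvectors. *)
Lemma spectrum_diag n (P : 'M[R[i]]_n) (d : 'rV[R[i]]_n) : P \is unitarymx ->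
  spectrum (P^t* *m diag_mx d *m P) = range (d 0).
Proof.
move=> uP; have PP := unitarymxP uP; have PP' := unitarymx_mulVmx uP.
apply/seteqP; split=> [l /eigenvalueP[v vW v0]|_ [j _ <-]].
  pose w := v *m P^t*.
  have wd : w *m diag_mx d = l *: w.
    by rewrite /w scalemxAl -vW -!mulmxA PP mulmx1.
  have [j wj] : exists j, w 0 j != 0.
    apply/rV0Pn; apply: contraNneq v0 => w0.
    by rewrite -[v]mulmx1 -PP' mulmxA -/w w0 mul0mx.
  clearbody w; exists j => //; have /rowP/(_ j) := wd.
  by rewrite mul_mx_diag !mxE mulrC => /(mulIf wj).
apply/eigenvalueP; exists (row j P).
  rewrite rowE !mulmxA -(mulmxA _ P) PP mulmx1 scalemxAl; congr (_ *m _).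
  apply/rowP => i; rewrite mul_mx_diag !mxE eqxx /=.
  by have [->|_] := eqVneq i j; rewrite ?mul1r ?mulr1 // mul0r mulr0.
apply: contraTneq isT => rj0.
have : row j (P *m P^t*) = 0 by rewrite row_mul rj0 mul0mx.
by rewrite PP => /rowP/(_ j)/eqP; rewrite !mxE eqxx oner_eq0.
Qed.

End DiagonalUnitary.
(** * Minimal curves *)

(** The alternative [T = 0] serves the empty family, where no index attains the maximum. *)
Lemma max_norm_attained (R : realType) n (th : 'I_n -> R) : exists T : R,
  [/\ 0 <= T, forall j, `|th j| <= T & T = 0 \/ exists k, `|th k| = T].
Proof.
case: n th => [|n] th; first by exists 0; split=> // [[]//|]; left.
pose k := [arg max_(k > ord0) `|th k|]%O.
exists `|th k|; split=> // [j|]; last by right; exists k.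
by rewrite /k; case: arg_maxP => // i _; apply.
Qed.

(** * Curves with prescribed phases in the eigenbasis *)

Section PhaseCurves.
Context {R : realType} {n : nat}.
Variables (U V P : 'M[R[i]]_n) (theta : 'I_n -> R).
Hypotheses (uU : U \is unitarymx) (uP : P \is unitarymx).
Hypothesis theta_pi : forall j, - pi < theta j <= pi.
Hypothesis UV : U^t* *m V = P^t* *m diag_mx (\row_j cexpi (theta j)) *m P.

Lemma rdot_cexpi (a : R) (x y : 'cV[R[i]]_n) :
  rdot x (cexpi a *: y) = cos a * rdot x y + sin a * rdot x ('i%C *: y).
Proof.
rewrite -!rdotZr -rdotDr scalerA -scalerDl; congr (rdot x (_ *: y)).
by apply/eqP; rewrite eq_complex /=; apply/andP; split; apply/eqP; ring.
Qed.

Lemma rdot_i (x : 'cV[R[i]]_n) : rdot x ('i%C *: x) = 0.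
Proof.
rewrite rdotE big1// => i _; rewrite mxE; case: (x i 0) => a b /=; ring.
Qed.

Let eigvec j : 'cV[R[i]]_n := P^t* *m delta_mx j 0.

(** Polynomial phases include the linear ones of the geodesic and the quadratic ones of its
    perturbations. *)
Definition phase_diag (q : 'I_n -> {poly R}) (t : R) : 'M[R[i]]_n :=
  diag_mx (\row_j cexpi (q j).[t]).

Definition phase_curve (q : 'I_n -> {poly R}) (t : R) : 'M[R[i]]_n :=
  U *m P^t* *m phase_diag q t *m P.

Let unitary_UP : U *m P^t* \is unitarymx.
Proof.
have uPC : P^t* \is unitarymx by rewrite trmxC_unitary.
exact: mul_unitarymx uU uPC.
Qed.

Lemma eigvec_norm j : l2norm (eigvec j) = 1.
Proof. by rewrite /eigvec l2norm_unitaryC// l2norm_delta. Qed.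

Lemma theta_norm_le_pi j : `|theta j| <= pi.
Proof. by rewrite ler_norml; have /andP[/ltW -> ->] := theta_pi j. Qed.

Lemma phase_diag_mul_eigvec (d : 'rV[R[i]]_n) j :
  U *m P^t* *m diag_mx d *m P *m eigvec j = d 0 j *: (U *m eigvec j).
Proof.
rewrite /eigvec -!mulmxA (mulmxA P) (unitarymxP uP) mul1mx mul_diag_delta.
by rewrite -!scalemxAr.
Qed.

Lemma phase_curve_eigvec q t j :
  phase_curve q t *m eigvec j = cexpi (q j).[t] *: (U *m eigvec j).
Proof. by rewrite phase_diag_mul_eigvec mxE. Qed.

Lemma V_phase : V = U *m P^t* *m diag_mx (\row_j cexpi (theta j)) *m P.
Proof.
have := congr1 (mulmx U) UV; rewrite mulmxA (unitarymxP uU) mul1mx => ->.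
by move: (P^t*) (diag_mx _) => Q D; rewrite !mulmxA.
Qed.

Lemma V_eigvec j : V *m eigvec j = cexpi (theta j) *: (U *m eigvec j).
Proof. by rewrite V_phase phase_diag_mul_eigvec mxE. Qed.

(** The vectors [eigvec j] are the columns of the invertible matrix [P^t*]. *)
Lemma eigvec_ext (A B : 'M[R[i]]_n) :
  (forall j, A *m eigvec j = B *m eigvec j) -> A = B.
Proof.
move=> AB; rewrite -[A]mulmx1 -[B]mulmx1 -(unitarymx_mulVmx uP) !mulmxA.
congr (_ *m _); apply/matrixP => i j.
have /colP/(_ i) := AB j; rewrite /eigvec !mulmxA -!colE.
by rewrite !mxE.
Qed.

Let phase_diag_re q i j : entry_re (phase_diag q) i j =
  fun t => ((i == j)%:R : {poly R}).[t] * cos (q j).[t] + (0 : {poly R}).[t] * sin (q j).[t].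
Proof.
apply/funext => t; rewrite /entry_re /phase_diag !mxE horner0 mul0r addr0.
by case: eqVneq => [->|_] /=; rewrite ?hornerC ?horner0 ?mul1r ?mul0r.
Qed.

Let phase_diag_im q i j : entry_im (phase_diag q) i j =
  fun t => (0 : {poly R}).[t] * cos (q j).[t] + ((i == j)%:R : {poly R}).[t] * sin (q j).[t].
Proof.
apply/funext => t; rewrite /entry_im /phase_diag !mxE horner0 mul0r add0r.
by case: eqVneq => [->|_] /=; rewrite ?hornerC ?horner0 ?mul1r ?mul0r.
Qed.

Lemma phase_diag_smooth q : mx_smooth (phase_diag q).
Proof.
by move=> i j; rewrite phase_diag_re phase_diag_im; split; exact: smooth_trig_poly.
Qed.

Lemma phase_diag_velocity q t : velocity (phase_diag q) t =
  diag_mx (\row_j ((0 +i* (deriv (q j)).[t]) * cexpi (q j).[t])).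
Proof.
apply/matrixP => i j; rewrite !mxE phase_diag_re phase_diag_im !derive1E.
rewrite !(@derive_val _ _ _ _ _ _ _ (is_derive_trig_poly _ _ _ _)).
have -> : deriv ((i == j)%:R : {poly R}) = 0 by rewrite -polyC_natr derivC.
rewrite deriv0 !mul0r !hornerE.
case: eqVneq => [->|_] /=; rewrite ?hornerC ?horner0 ?mulr1n ?mulr0n.
  by apply/eqP; rewrite eq_complex /=; apply/andP; split; apply/eqP; ring.
by apply/eqP; rewrite eq_complex /=; apply/andP; split; apply/eqP; ring.
Qed.

Lemma phase_curve_smooth q : mx_smooth (phase_curve q).
Proof. exact/mx_smooth_mulmx/phase_diag_smooth. Qed.

Lemma phase_curve_speed q t (c : R) : 0 <= c ->
  (forall j, `|(deriv (q j)).[t]| <= c) ->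
  c = 0 \/ (exists k, `|(deriv (q k)).[t]| = c) ->
  spectral_norm (velocity (phase_curve q) t) = c.
Proof.
move=> c0 qc cmax.
have D := mx_smooth_derivable t (phase_diag_smooth q).
rewrite (velocity_mulmx _ _ D) phase_diag_velocity.
apply: spectral_norm_diag => // [j|]; first by rewrite mxE normc_iscale_cexpi.
by case: cmax => [->|[k kc]]; [left|right; exists k; rewrite mxE normc_iscale_cexpi].
Qed.

Lemma phase_curve_joins q : (forall j, (q j).[0] = 0) ->
  (forall j, cexpi (q j).[1] = cexpi (theta j)) -> joins U V (phase_curve q).
Proof.
move=> q0 q1; split.
- exists [:: 1]; split; first by apply: itv_partition1; exact: ltr01.
  by move=> k _; exists (phase_curve q); split=> [|t _]; [exact: phase_curve_smooth|exact: erefl].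
- move=> t _; suff uD : phase_diag q t \is unitarymx.
    exact: mul_unitarymx (mul_unitarymx unitary_UP uD) uP.
  apply/unitarymxP; rewrite /phase_diag tr_diag_mx map_diag_mx mulmx_diag.
  apply/matrixP => i j; rewrite !mxE; case: eqVneq => // _.
  by rewrite mulrC conj_cexpi_mul.
- apply: eigvec_ext => j; rewrite phase_curve_eigvec q0.
  by rewrite cexpi0 scale1r.
- by apply: eigvec_ext => j; rewrite phase_curve_eigvec q1 V_eigvec.
Qed.

(** * Length bound and rigidity for an arbitrary curve from U to V *)

Section CurveFromUtoV.
Variables (b : R -> 'M[R[i]]_n) (b_joins : joins U V b).

Let speed_ge0 t : 0 <= spectral_norm (velocity b t).
Proof. exact: spectral_norm_ge0. Qed.

(** The eigenvector's endpoints have inner product [cos (theta j)]. A shorter curve would have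
    finite length below [pi], and the orbit bound would contradict the strict decrease of cosine on
    [[0, pi]]. *)
Lemma curve_length_ge_angle j : (`|theta j|%:E <= curve_length b)%E.
Proof.
have [pb ub b0 b1] := b_joins.
have [cb [S bS]] := piecewise_smooth_off pb.
rewrite leNgt; apply/negP => short.
have fin : (curve_length b < +oo)%E by rewrite (lt_trans short) ?ltry.
have [G [cG DG G01]] := finite_exception_primitive
  (fun x x01 xS => smooth_off_speed_continuous bS x01 xS) speed_ge0 fin.
have : (0 <= curve_length b)%E by apply: integral_ge0 => t _; rewrite lee_fin.
move: short; rewrite /curve_length -G01 lee_fin lte_fin => Gth G0.
have Gpi := le_trans (ltW Gth) (theta_norm_le_pi j).
have DG' (u : R) : u \in `]0, 1[ -> u \notin S -> exists2 dG, is_derive u 1 G dG &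
    spectral_norm (velocity b u) <= dG.
  by move=> u01 uS; exists (spectral_norm (velocity b u)) => //; exact: DG.
have := orbit_rdot_ge bS ub cb cG DG' (eigvec_norm j) (lexx 0) ler01 (lexx 1) Gpi.
have Uj1 : rdot (U *m eigvec j) (U *m eigvec j) = 1.
  by apply/l2norm1P; rewrite (l2norm_unitary _ uU) eigvec_norm.
rewrite b0 b1 V_eigvec rdot_cexpi rdot_i mulr0 addr0 Uj1 mulr1 leNgt.
rewrite -(cos_norm (theta j)) ltr_cos ?Gth// in_itv/=.
  by rewrite G0.
by rewrite normr_ge0 theta_norm_le_pi.
Qed.

(* A minimal curve moves each eigenvector at speed at most T = |theta_j|, the
   spherical distance of its endpoints, hence along the great circle. *)
Lemma constant_speed_eigvec (T : R) j t : T < pi -> `|theta j| = T ->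
  constant_speed b -> curve_length b = T%:E -> t \in `[0, 1] ->
  b t *m eigvec j = cexpi (theta j * t) *: (U *m eigvec j).
Proof.
move=> Tpi thT [c bc] lenb t01; have [pb ub b0 b1] := b_joins.
have [cb [S bS]] := piecewise_smooth_off pb.
have T0 : 0 <= T by rewrite -thT.
have speed_c (u : R) : u \in `]0, 1[ -> u \notin S -> spectral_norm (velocity b u) = c.
  by move=> u01 uS; exact: bc u u01 (smooth_off_derivable bS u01 uS).
(* The speed is [c] off finitely many points, so the length over the unit interval is [c]. *)
have cT : c = T.
  apply: EFin_inj; rewrite -lenb /curve_length.
  rewrite (finite_exception_integral_cst _ speed_c)//.
  by move=> x x01 xS; exact: smooth_off_speed_continuous bS x01 xS.
have cG : {within `[0, 1], continuous (fun u : R => T * u)}.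
  by apply: continuous_subspaceT => u; apply: cvgZ; [exact: cvg_cst|exact: cvg_id].
have DG (u : R) : u \in `]0, 1[ -> u \notin S ->
    exists2 dG, is_derive u 1 (fun u : R => T * u) dG & spectral_norm (velocity b u) <= dG.
  move=> u01 uS; exists T; last by rewrite speed_c// cT.
  by apply: is_derive_eq; rewrite /GRing.scale/= mulr1.
have /andP[t0 t1] : 0 <= t <= 1 by move: t01; rewrite in_itv.
(* The orbit bound with [G u = T * u]; it is used from time 0 to [t] and from [t] to 1. *)
have bound s u : 0 <= s -> s <= u -> u <= 1 ->
    cos (T * (u - s)) <= rdot (b s *m eigvec j) (b u *m eigvec j).
  move=> s0 su u1; rewrite mulrBr.
  apply: (orbit_rdot_ge bS ub cb cG DG (eigvec_norm j) s0 su u1).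
  rewrite -mulrBr (le_trans _ (ltW Tpi))// ler_piMr//; lra.
have Uj1 : l2norm (U *m eigvec j) = 1 by rewrite (l2norm_unitary _ uU) eigvec_norm.
have Bj1 : l2norm (b t *m eigvec j) = 1.
  by rewrite (l2norm_unitary _ (ub t t01)) eigvec_norm.
apply: rdot_ge1_eq => //; first by rewrite l2normZ normc_cexpi mul1r.
rewrite rdot_cexpi.
have := bound 0 t (lexx 0) t0 t1; rewrite b0 subr0 rdotC => HA.
have := bound t 1 t0 t1 (lexx 1); rewrite b1 V_eigvec rdot_cexpi => HB.
have Tt : 0 <= T < pi by rewrite T0.
have t01' : 0 <= t <= 1 by rewrite t0.
(* [A] and [B] are the components of [b t *m eigvec j] along [U *m eigvec j] and its multiple by
   ['i], which span the plane of the great circle. *)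
move: HA HB; set A := rdot _ (U *m _); set B := rdot _ ('i%C *: _) => HA HB.
have [th0|th0] := leP 0 (theta j).
  by move: HB; rewrite -(ger0_norm th0) thT; exact: geodesic_point_le Tt t01' HA.
(* A negative angle traverses the circle the other way, which amounts to replacing [B] by [- B]. *)
have thE : theta j = - T by rewrite -thT ltr0_norm// opprK.
move: HB; rewrite thE mulNr !cosN !sinN !mulNr -!mulrN.
exact: geodesic_point_le Tt t01' HA.
Qed.

End CurveFromUtoV.

(** * Distance and uniqueness in terms of the largest angle *)

Section MaximalAngle.
Variable T : R.
Hypotheses (T0 : 0 <= T) (theta_T : forall j, `|theta j| <= T).
Hypothesis T_attained : T = 0 \/ exists k, `|theta k| = T.

Let phase_curve_length q :
  (forall t, t \in `[0, 1] -> spectral_norm (velocity (phase_curve q) t) = T) ->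
  curve_length (phase_curve q) = T%:E.
Proof.
move=> qT; rewrite /curve_length.
rewrite (eq_integral (cst T%:E)) => [|t]; last by rewrite inE => t01; rewrite qT.
by rewrite integral_cst//= lebesgue_measure_itv/= lte_fin ltr01 oppr0 adde0 mule1.
Qed.

(** Conditions making [phase_curve q] minimal: it joins [U] to [V], no phase moves faster than [T],
    and one phase moves at speed [T] throughout, which makes the speed constant. *)
Let admissible q := [/\ forall j, (q j).[0] = 0,
  forall j, cexpi (q j).[1] = cexpi (theta j),
  forall j t, t \in `[0, 1] -> `|(deriv (q j)).[t]| <= T &
  T = 0 \/ exists k, forall t, t \in `[0, 1] -> `|(deriv (q k)).[t]| = T].

Let admissible_speed q t : admissible q -> t \in `[0, 1] ->
  spectral_norm (velocity (phase_curve q) t) = T.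
Proof.
move=> [_ _ qT qmax] t01; apply: phase_curve_speed => // [j|]; first exact: qT.
by case: qmax => [->|[k kT]]; [left|right; exists k; exact: kT].
Qed.

Let linear_phase j : {poly R} := theta j *: 'X.

Let linear_phase_admissible : admissible linear_phase.
Proof.
have D j : deriv (linear_phase j) = (theta j)%:P by rewrite derivZ derivX alg_polyC.
split=> [j|j|j t _|]; rewrite ?hornerZ ?hornerX ?mulr0 ?mulr1//.
  by rewrite D hornerC.
by case: T_attained => [->|[k kT]]; [left|right; exists k => t _; rewrite D hornerC].
Qed.

Lemma dist_spectral_angle : dist_spectral U V = T%:E.
Proof.
apply/le_anti/andP; split.
  have [q0 q1 _ _] := linear_phase_admissible.
  rewrite -(phase_curve_length (fun t => admissible_speed linear_phase_admissible)).
  apply: ereal_inf_lbound; exists (phase_curve linear_phase); last exact: erefl.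
  exact: phase_curve_joins.
apply: le_ereal_inf_tmp => _ [b /= b_joins <-].
(* The lower bound comes from an eigenvector of largest angle, or from nonnegativity when
   [T = 0]. *)
have [->|[k <-]] := T_attained; last exact: curve_length_ge_angle.
by apply: integral_ge0 => t _; rewrite lee_fin spectral_norm_ge0.
Qed.

Let admissible_minimal q : admissible q -> minimal_curve U V (phase_curve q).
Proof.
move=> qadm; have [q0 q1 _ _] := qadm; split; first exact: phase_curve_joins.
  by rewrite dist_spectral_angle phase_curve_length// => t; exact: admissible_speed.
by exists T => t t01 _; apply: admissible_speed => //; exact: subset_itv_oo_cc.
Qed.

Lemma unique_minimal_curve_of_angles : T < pi -> (forall j, `|theta j| = T) ->
  unique_minimal_curve U V.
Proof.
move=> Tpi thT; have amin := admissible_minimal linear_phase_admissible.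
exists (phase_curve linear_phase); split=> // b [b_joins lenb cb] t t01.
apply: eigvec_ext => j; rewrite phase_curve_eigvec hornerZ hornerX.
apply: (constant_speed_eigvec b_joins Tpi (thT j) cb) => //.
by rewrite lenb dist_spectral_angle.
Qed.

(** Test for non-uniqueness: an admissible [q] whose phase differs from the linear one modulo
    [2 * pi] at the midpoint gives a second minimal curve. *)
Let minimal_phase_half q j : unique_minimal_curve U V -> admissible q ->
  cexpi (theta j / 2) = cexpi (q j).[1 / 2].
Proof.
move=> [a [_ uniq_a]] qadm.
have half01 : (1 / 2 : R) \in `[0, 1] by rewrite in_itv/=; apply/andP; split; lra.
have E := uniq_a _ (admissible_minimal qadm) _ half01.
have := uniq_a _ (admissible_minimal linear_phase_admissible) _ half01.
rewrite -E => /(congr1 (fun M => M *m eigvec j)).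
rewrite !phase_curve_eigvec hornerZ hornerX mul1r => /eqP.
rewrite -subr_eq0 -scalerBl scaler_eq0 subr_eq0 => /orP[/eqP//|/eqP Uj0].
have := l2norm_unitary (eigvec j) uU.
by rewrite Uj0 l2norm0 eigvec_norm => /eqP; rewrite eq_sym oner_eq0.
Qed.

Lemma angles_of_unique_minimal_curve : unique_minimal_curve U V ->
  T < pi /\ forall j, `|theta j| = T.
Proof.
move=> uniq_UV; split.
  have [->|[k kT]] := T_attained; first exact: pi_gt0.
  rewrite -kT lt_neqAle theta_norm_le_pi andbT; apply/eqP => thpi.
  (* The value [- pi] is excluded by the half-open range of the angles. *)
  have thk : theta k = pi.
    have /andP[thN _] := theta_pi k.
    by have [h|h] := leP 0 (theta k); move: thpi; [rewrite ger0_norm|rewrite ltr0_norm//; lra].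
  pose q j : {poly R} := (if j == k then - pi else theta j) *: 'X.
  have D j : deriv (q j) = (if j == k then - pi else theta j)%:P.
    by rewrite derivZ derivX alg_polyC.
  have qadm : admissible q.
    split=> [j|j|j t _|]; rewrite ?hornerZ ?hornerX ?mulr0 ?mulr1//.
    - by case: eqVneq => // ->; rewrite thk /cexpi cosN sinN sinpi oppr0.
    - rewrite D hornerC; case: eqVneq => // _.
      by rewrite normrN -kT thpi ger0_norm ?pi_ge0.
    - right; exists k => t _; rewrite D hornerC eqxx normrN -kT thpi.
      by rewrite ger0_norm ?pi_ge0.
  have := minimal_phase_half k uniq_UV qadm.
  (* At the midpoint the two phases are [pi / 2] and [- pi / 2], opposite points of the circle. *)
  rewrite hornerZ hornerX eqxx thk; apply: cexpi_neq.
  by have := pi_gt0 R; move=> pi0; apply/andP; split; lra.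
move=> j; apply/eqP; rewrite eq_le theta_T /= leNgt; apply/negP => jT.
pose e := T - `|theta j|; have e0 : 0 < e by rewrite subr_gt0.
(* [T = 0] is impossible here, as an absolute value lies strictly below [T]. The index [k] differs
   from [j] and keeps the speed at [T]. *)
have [k kT] : exists k, `|theta k| = T.
  by case: T_attained => // T_eq0; move: jT; rewrite T_eq0 normr_lt0.
(* The bump [t - t^2] vanishes at both ends and its slope [1 - 2 * t] stays within [[-1, 1]], so
   phase [j] moves at speed at most [|theta j| + e = T]. *)
pose q i : {poly R} := theta i *: 'X + (if i == j then e else 0) *: ('X - 'X ^+ 2).
have qE i t : (q i).[t] = theta i * t + (if i == j then e else 0) * (t - t ^+ 2).
  by rewrite !hornerE.
have D i t : (deriv (q i)).[t] = theta i + (if i == j then e else 0) * (1 - 2 * t).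
  rewrite derivD !derivZ derivB derivX derivXn !hornerE /=; ring.
have qadm : admissible q.
  split=> [i|i|i t|].
  - by rewrite qE expr0n subrr !mulr0 addr0.
  - by rewrite qE expr1n subrr mulr0 addr0 mulr1.
  - rewrite in_itv/= D => /andP[t0 t1]; case: eqVneq => [->|_]; last first.
      by rewrite mul0r addr0.
    rewrite (le_trans (ler_normD _ _))// -lerBrDl -/e normrM gtr0_norm//.
    by rewrite ler_piMr ?(ltW e0)// ler_norml; apply/andP; split; lra.
  - right; exists k => t _; rewrite D; case: eqVneq => [kj|_].
      by move: jT; rewrite -kj kT ltxx.
    by rewrite mul0r addr0.
have := minimal_phase_half j uniq_UV qadm; rewrite qE eqxx => /esym.
have Tpi : T <= pi by rewrite -kT theta_norm_le_pi.
(* At the midpoint the phases differ by [e / 4], which is positive and at most [pi]. *)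
apply: cexpi_neq; have := normr_ge0 (theta j); have := pi_gt0 R.
by rewrite /e in e0 *; move=> pi0 th0; apply/andP; split; nra.
Qed.

End MaximalAngle.
End PhaseCurves.

(** * From angles to the spectrum of the relative unitary *)

Theorem corollary2p2 (R : realType) (n : nat) (U V : 'M[R[i]]_n)
    (hU : U \is unitarymx) (hV : V \is unitarymx) :
  unique_minimal_curve U V <->
  exists theta : R, `|theta| < pi /\
    spectrum (U^t* *m V) `<=` [set cexpi theta; cexpi (- theta)].
Proof.
have uUC : U^t* \is unitarymx by rewrite trmxC_unitary; exact: hU.
have [P [th [uP thpi UV]]] := unitary_diag (mul_unitarymx uUC hV).
have specE : spectrum (U^t* *m V) = range (fun j => cexpi (th j)).
  rewrite UV spectrum_diag//; apply/seteqP.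
  by split=> _ [j _ <-]; exists j => //; rewrite mxE.
have [T [T0 thT Tmax]] : exists T : R,
    [/\ 0 <= T, forall j, `|th j| <= T & T = 0 \/ exists k, `|th k| = T].
  exact: max_norm_attained.
split=> [uniq_UV|[theta [thetapi spec]]].
  have [Tpi th_eq] := angles_of_unique_minimal_curve hU uP thpi UV T0 thT Tmax uniq_UV.
  exists T; split; first by rewrite ger0_norm.
  rewrite specE => _ [j _ <-]; rewrite -(th_eq j).
  by have [h|h] := leP 0 (th j); [left; rewrite ger0_norm|right; rewrite ltr0_norm// opprK].
(* Each eigenvalue is one of the two conjugate points, which determines its angle up to sign. *)
have th_theta j : `|th j| = `|theta|.
  apply: cexpi_angle_norm; [exact: theta_norm_le_pi|exact: ltW|].
  by apply: spec; rewrite specE; exists j.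
have T_theta j : `|th j| = T.
  have [T_eq0|[k <-]] := Tmax; last by rewrite !th_theta.
  by apply/le_anti; rewrite thT T_eq0 normr_ge0.
apply: (unique_minimal_curve_of_angles hU uP thpi UV T0 thT Tmax _ T_theta).
(* If [T = 0] the bound is the positivity of [pi], which also settles dimension 0; otherwise [T]
   equals the absolute value of [theta]. *)
by have [->|[k <-]] := Tmax; rewrite ?pi_gt0// th_theta.
Qed.
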